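(* Let $A=\bigoplus_{i=1}^m B(X_i)$ and $B=\bigoplus_{j=1}^n B(Y_j)$, let $H$ be a finite-dimensional Hilbert space with fixed orthonormal basis $\{|h\rangle\}$, and let $M:A\otimes B(H)\to B$ be a channel with minimal dilation $\tau_{ij}:X_i\otimes H\to Y_j\otimes E_{ji}$. Then $M$ is entanglement-invertible with respect to the canonical maximally entangled state $\Phi_H$ of $H\otimes H$ if and only if both of the following hold: (a) for every $i\in[m]$ the map $U_i:X_i\otimes H\to\bigoplus_{j}(Y_j\otimes E_{ji})$, $\xi\mapsto(\tau_{ij}\xi)_{j}$, is unitary; (b) for every $j\in[n]$ the map $W_j:\bigoplus_i (X_i\otimes E_{ji})\to Y_j\otimes H$, $(\xi_i)_i\mapsto\sum_i\sqrt{\dim X_i/\dim Y_j}\;\tilde\tau_{ij}\xi_i$, is unitary. Moreover, in this case the entanglement-inverse $N:B\otimes B(H)\to A$ is unique and is given by $N\big(\bigoplus_j\rho_j\big)=\bigoplus_i\sum_j \frac{\dim X_i}{\dim Y_j}\,\mathrm{Tr}_{E_{ji}}\big(\tilde\tau_{ij}^\dagger\rho_j\tilde\tau_{ij}\big)$ for $\rho_j\in B(Y_j\otimes H)$.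
   Context: All Hilbert spaces are finite-dimensional. A channel between finite-dimensional $C^*$-algebras is a completely positive trace-preserving linear map (acting on states). Write $A=\bigoplus_{i=1}^m B(X_i)$, $B=\bigoplus_{j=1}^n B(Y_j)$, so $\dim A=\sum_i(\dim X_i)^2$, and identify $A\otimes B(H)=\bigoplus_i B(X_i\otimes H)$. A channel $M:A\otimes B(H)\to B$ has components $M_{ij}:B(X_i\otimes H)\to B(Y_j)$ with $M(\oplus_i\rho_i)=\oplus_j\sum_iM_{ij}(\rho_i)$. A minimal dilation of $M$ is a family of linear maps $\tau_{ij}:X_i\otimes H\to Y_j\otimes E_{ji}$ ($E_{ji}$ Hilbert spaces, possibly zero) with $M_{ij}(\rho)=\mathrm{Tr}_{E_{ji}}(\tau_{ij}\rho\tau_{ij}^\dagger)$ such that, for an orthonormal basis $\{e_k\}$ of $E_{ji}$, the operators $(1_{Y_j}\otimes\langle e_k|)\tau_{ij}$ are linearly independent; trace preservation means $\sum_j\tau_{ij}^\dagger\tau_{ij}=1$ for all $i$. Fix an orthonormal basis $\{|h\rangle\}$ of $H$ and orthonormal bases $\{e_k\}$ of each $E_{ji}$; the partial transpose $\tilde\tau_{ij}:X_i\otimes E_{ji}\to Y_j\otimes H$ is the linear map $\tilde\tau_{ij}(x\otimes e_k)=\sum_h\big[(1_{Y_j}\otimes\langle e_k|)\tau_{ij}(x\otimes |h\rangle)\big]\otimes|h\rangle$. Let $|\eta_H\rangle=\sum_h|h\rangle\otimes|h\rangle$ and let $\Phi_H=|\eta_H\rangle\langle\eta_H|/\dim H$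 be the canonical maximally entangled state. Entanglement-reversibility/invertibility: let $W$ be a state (density operator) on $H_1\otimes H_2$ and $W'$ the same state with tensor factors swapped. A channel $M:A\otimes B(H_1)\to B$ is entanglement-reversible with respect to $W$ if there is a channel $N:B\otimes B(H_2)\to A$ (an entanglement-left inverse) with $N\big((M\otimes\mathrm{id}_{B(H_2)})(\rho\otimes W)\big)=\rho$ for all $\rho\in A$; it is entanglement-invertible with respect to $W$ if moreover $M\big((N\otimes\mathrm{id}_{B(H_1)})(\sigma\otimes W')\big)=\sigma$ for all $\sigma\in B$, and then $N$ is called an entanglement-inverse. Here $H_1=H_2=H$ and $W=\Phi_H$. *)

(* Defs.v *)
(* Finite-dimensional quantum channels between multi-matrix
   algebras, with operators represented by their kernels (matrix entries)
   indexed by finite types (orthonormal bases). *)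
From HB Require Import structures.
From mathcomp Require Import all_boot all_order all_algebra.
Unset Printing Implicit Defensive.
Import Order.TTheory GRing.Theory Num.Theory.
Local Open Scope ring_scope.

(* A linear map from the space with basis J to the space with basis I,
   given by its matrix entries  A i j = <i| A |j>. *)
Definition mat (C : numClosedFieldType) (I J : finType) := I -> J -> C.
Arguments mat C I%_type J%_type.

Definition mmul {C : numClosedFieldType} {I J K : finType}
  (A : mat C I J) (B : mat C J K) : mat C I K :=
  fun i k => \sum_j A i j * B j k.

Definition adj {C : numClosedFieldType} {I J : finType} (A : mat C I J) : mat C J I :=
  fun j i => (A i j)^*.

Definition idm {C : numClosedFieldType} {I : finType} : mat C I I :=
  fun i j => (i == j)%:R.

Definition unitary {C : numClosedFieldType} {I J : finType} (U : mat C I J) :=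
  mmul (adj U) U = idm /\ mmul U (adj U) = idm.

Definition psd {C : numClosedFieldType} {I : finType} (A : mat C I I) :=
  forall v : I -> C, 0 <= \sum_a \sum_b (v a)^* * A a b * v b.

(* The multi-matrix algebra  (+)_k B(D k). *)
Definition malg (C : numClosedFieldType) {K : finType} (D : K -> finType) :=
  forall k, mat C (D k) (D k).

Definition madd {C : numClosedFieldType} {K : finType} {D : K -> finType}
  (x y : malg C D) : malg C D := fun k a b => x k a b + y k a b.
Definition mscale {C : numClosedFieldType} {K : finType} {D : K -> finType}
  (c : C) (x : malg C D) : malg C D := fun k a b => c * x k a b.

Definition mlinear {C : numClosedFieldType} {K1 K2 : finType}
  {D1 : K1 -> finType} {D2 : K2 -> finType} (f : malg C D1 -> malg C D2) :=
  forall c x y, f (madd (mscale c x) y) = madd (mscale c (f x)) (f y).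

Definition mpos {C : numClosedFieldType} {K : finType} {D : K -> finType}
  (x : malg C D) := forall k, psd (x k).

Definition mtrace {C : numClosedFieldType} {K : finType} {D : K -> finType}
  (x : malg C D) : C := \sum_k \sum_a x k a a.

(* tensoring every summand with a fixed space T:  A (x) B(T) *)
Definition prodD {K : finType} (D : K -> finType) (T : finType) : K -> finType :=
  fun k => (D k * T)%type.

(* f (x) id_{B(T)} *)
Definition ampl {C : numClosedFieldType} {K1 K2 : finType}
  {D1 : K1 -> finType} {D2 : K2 -> finType} (T : finType)
  (f : malg C D1 -> malg C D2) : malg C (prodD D1 T) -> malg C (prodD D2 T) :=
  fun x k p q => f (fun k' a b => x k' (a, p.2) (b, q.2)) k p.1 q.1.
Arguments ampl {C K1 K2 D1 D2} T f x k p q.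

Definition cp {C : numClosedFieldType} {K1 K2 : finType}
  {D1 : K1 -> finType} {D2 : K2 -> finType} (f : malg C D1 -> malg C D2) :=
  forall (p : nat) (x : malg C (prodD D1 'I_p)), mpos x -> mpos (ampl 'I_p f x).

Definition channel {C : numClosedFieldType} {K1 K2 : finType}
  {D1 : K1 -> finType} {D2 : K2 -> finType} (f : malg C D1 -> malg C D2) :=
  [/\ mlinear f, cp f & forall x, mtrace (f x) = mtrace x].

(* rho (x) W  in  A (x) B(T1 (x) T2) = (+)_k B(D k (x) T1 (x) T2) *)
Definition mtens {C : numClosedFieldType} {K : finType} {D : K -> finType}
  {T1 T2 : finType} (x : malg C D) (W : mat C (T1 * T2) (T1 * T2))
  : malg C (prodD (prodD D T1) T2) :=
  fun k p q => x k p.1.1 q.1.1 * W (p.1.2, p.2) (q.1.2, q.2).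

Definition swapst {C : numClosedFieldType} {T1 T2 : finType}
  (W : mat C (T1 * T2) (T1 * T2)) : mat C (T2 * T1) (T2 * T1) :=
  fun p q => W (p.2, p.1) (q.2, q.1).

Definition ent_left_inverse {C : numClosedFieldType} {KA KB : finType}
  {DA : KA -> finType} {DB : KB -> finType} {H1 H2 : finType}
  (M : malg C (prodD DA H1) -> malg C DB) (N : malg C (prodD DB H2) -> malg C DA)
  (W : mat C (H1 * H2) (H1 * H2)) :=
  channel N /\ forall rho : malg C DA, N (ampl H2 M (mtens rho W)) = rho.

Definition ent_reversible {C : numClosedFieldType} {KA KB : finType}
  {DA : KA -> finType} {DB : KB -> finType} {H1 H2 : finType}
  (M : malg C (prodD DA H1) -> malg C DB) (W : mat C (H1 * H2) (H1 * H2)) :=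
  exists N : malg C (prodD DB H2) -> malg C DA, ent_left_inverse M N W.

Definition ent_inverse {C : numClosedFieldType} {KA KB : finType}
  {DA : KA -> finType} {DB : KB -> finType} {H1 H2 : finType}
  (M : malg C (prodD DA H1) -> malg C DB) (N : malg C (prodD DB H2) -> malg C DA)
  (W : mat C (H1 * H2) (H1 * H2)) :=
  ent_left_inverse M N W /\
  forall sigma : malg C DB, M (ampl H1 N (mtens sigma (swapst W))) = sigma.

Definition ent_invertible {C : numClosedFieldType} {KA KB : finType}
  {DA : KA -> finType} {DB : KB -> finType} {H1 H2 : finType}
  (M : malg C (prodD DA H1) -> malg C DB) (W : mat C (H1 * H2) (H1 * H2)) :=
  exists N : malg C (prodD DB H2) -> malg C DA, ent_inverse M N W.

(* canonical maximally entangled state  |eta_H><eta_H| / dim H *)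
Definition maxent (C : numClosedFieldType) (H : finType) : mat C (H * H) (H * H) :=
  fun p q => ((p.1 == p.2) && (q.1 == q.2))%:R / #|H|%:R.

(* ---- Concrete setting: X_i = C^(dX i), Y_j = C^(dY j), H = C^dH,
        E_ji = C^(dE j i), with their standard orthonormal bases. ---- *)
Definition dimsp {k : nat} (d : 'I_k -> nat) : 'I_k -> finType := fun i => 'I_(d i).

Notation dil_type C dX dY dH dE :=
  (forall i j, mat C ('I_(dY j) * 'I_(dE j i)) ('I_(dX i) * 'I_dH)).

(* M_ij(rho) = Tr_{E_ji}(tau_ij rho tau_ij^dagger) *)
Definition dil_comp {C : numClosedFieldType} {m n : nat} {dX : 'I_m -> nat}
  {dY : 'I_n -> nat} {dH : nat} {dE : 'I_n -> 'I_m -> nat}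
  (tau : dil_type C dX dY dH dE) (i : 'I_m) (j : 'I_n)
  (rho : mat C ('I_(dX i) * 'I_dH) ('I_(dX i) * 'I_dH)) : mat C 'I_(dY j) 'I_(dY j) :=
  fun y y' => \sum_(e : 'I_(dE j i)) \sum_a \sum_b
                tau i j (y, e) a * rho a b * (tau i j (y', e) b)^*.

Definition min_dilation {C : numClosedFieldType} {m n : nat} {dX : 'I_m -> nat}
  {dY : 'I_n -> nat} {dH : nat} {dE : 'I_n -> 'I_m -> nat}
  (tau : dil_type C dX dY dH dE)
  (M : malg C (prodD (dimsp dX) 'I_dH) -> malg C (dimsp dY)) :=
  (forall rho (j : 'I_n) y y',
      M rho j y y' = \sum_(i : 'I_m) dil_comp tau i j (rho i) y y') /\
  (forall (i : 'I_m) (j : 'I_n) (c : 'I_(dE j i) -> C),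
      (forall y a, \sum_e c e * tau i j (y, e) a = 0) -> forall e, c e = 0).

Definition dil_trace_pres {C : numClosedFieldType} {m n : nat} {dX : 'I_m -> nat}
  {dY : 'I_n -> nat} {dH : nat} {dE : 'I_n -> 'I_m -> nat}
  (tau : dil_type C dX dY dH dE) :=
  forall (i : 'I_m) a b,
    \sum_(j : 'I_n) \sum_p (tau i j p a)^* * tau i j p b = (a == b)%:R.

Definition Umap {C : numClosedFieldType} {m n : nat} {dX : 'I_m -> nat}
  {dY : 'I_n -> nat} {dH : nat} {dE : 'I_n -> 'I_m -> nat}
  (tau : dil_type C dX dY dH dE) (i : 'I_m)
  : mat C {j : 'I_n & ('I_(dY j) * 'I_(dE j i))%type} ('I_(dX i) * 'I_dH) :=
  fun p a => tau i (tag p) (tagged p) a.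

Definition ptrans {C : numClosedFieldType} {m n : nat} {dX : 'I_m -> nat}
  {dY : 'I_n -> nat} {dH : nat} {dE : 'I_n -> 'I_m -> nat}
  (tau : dil_type C dX dY dH dE) (i : 'I_m) (j : 'I_n)
  : mat C ('I_(dY j) * 'I_dH) ('I_(dX i) * 'I_(dE j i)) :=
  fun q p => tau i j (q.1, p.2) (p.1, q.2).

Definition Wmap {C : numClosedFieldType} {m n : nat} {dX : 'I_m -> nat}
  {dY : 'I_n -> nat} {dH : nat} {dE : 'I_n -> 'I_m -> nat}
  (tau : dil_type C dX dY dH dE) (j : 'I_n)
  : mat C ('I_(dY j) * 'I_dH) {i : 'I_m & ('I_(dX i) * 'I_(dE j i))%type} :=
  fun q p => sqrtC ((dX (tag p))%:R / (dY j)%:R) * ptrans tau (tag p) j q (tagged p).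

Definition Nform {C : numClosedFieldType} {m n : nat} {dX : 'I_m -> nat}
  {dY : 'I_n -> nat} {dH : nat} {dE : 'I_n -> 'I_m -> nat}
  (tau : dil_type C dX dY dH dE) (rho : malg C (prodD (dimsp dY) 'I_dH))
  : malg C (dimsp dX) :=
  fun i x x' => \sum_(j : 'I_n) ((dX i)%:R / (dY j)%:R) *
     \sum_(e : 'I_(dE j i)) \sum_a \sum_b
        (ptrans tau i j a (x, e))^* * rho j a b * ptrans tau i j b (x', e).

(* Main.v *)
Require Import Defs.
From HB Require Import structures.
From mathcomp Require Import all_boot all_order all_algebra ring.
From Stdlib Require Import FunctionalExtensionality.
Import Order.TTheory GRing.Theory Num.Theory.
Local Open Scope ring_scope.

(* Write [M] and [N] in Kraus form, with operators [K_e] and [L_f]; slicing them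
   along the basis of [H], the composites [N (M (x) id)] and [M (N (x) id)] have
   Kraus operators [sum_h L_(f,h) K_(e,h)] and [sum_h K_(e,h) L_(f,h)].
   Kraus operators of an identity channel are scalars, supported on the diagonal
   blocks.  As the [U_i] are isometries, this scalarity solves for
   [L_f = sum_e mu_(f,e) K_e^*] (partially transposed); symmetrically
   [K_e = sum_f lambda_(f,e) L_f^*], where [lambda dim X_i = mu dim Y_j] by
   cyclicity of the trace.  Minimality then makes [mu] unitary up to the factor
   [sqrt (dim X_i / dim Y_j)]; cancelling it from the scalarity relations gives
   the unitarity of [U_i] and [W_j] and the formula for [N].  Conversely,
   unitarity makes [L_e = sqrt (dim X_i / dim Y_j) K_e^*] satisfy them. *)

(** * Positive semidefinite kernels and their Gram factorisations *)

Definition sesq {C : numClosedFieldType} {I : finType} (A : mat C I I)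
  (u w : I -> C) : C := \sum_a \sum_b (u a)^* * A a b * w b.

Definition ket {C : numClosedFieldType} {I : finType} (a : I) : I -> C :=
  fun x => (x == a)%:R.

Lemma sum_delta {R : pzSemiRingType} {I : finType} (a : I) (F : I -> R) :
  \sum_x (x == a)%:R * F x = F a.
Proof.
rewrite (bigD1 a) //= eqxx mul1r big1 ?addr0 // => x /negPf ->.
by rewrite mul0r.
Qed.

Lemma sesq_ket {C : numClosedFieldType} {I : finType} (A : mat C I I) a b :
  sesq A (ket a) (ket b) = A a b.
Proof.
rewrite /sesq /ket.
under eq_bigr => x _ do
  (under eq_bigr => y _ do rewrite conjC_nat -mulrA [A x y * _]mulrC).
under eq_bigr => x _ do rewrite -big_distrr /= sum_delta.
by rewrite sum_delta.
Qed.

Lemma sesq_ketl {C : numClosedFieldType} {I : finType} (A : mat C I I) a w :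
  sesq A (ket a) w = \sum_b A a b * w b.
Proof.
rewrite /sesq /ket.
under eq_bigr => x _ do
  (under eq_bigr => y _ do rewrite conjC_nat -mulrA).
under eq_bigr => x _ do rewrite -big_distrr /=.
by rewrite sum_delta.
Qed.

Lemma sesq_line {C : numClosedFieldType} {I : finType} (A : mat C I I)
  (v w : I -> C) c :
  sesq A (fun x => v x + c * w x) (fun x => v x + c * w x) =
  sesq A v v + c * sesq A v w + c^* * sesq A w v + c * c^* * sesq A w w.
Proof.
rewrite /sesq 3!big_distrr -3!big_split /=; apply: eq_bigr => a _.
rewrite 3!big_distrr -3!big_split /=; apply: eq_bigr => b _.
by rewrite rmorphD rmorphM /=; ring.
Qed.

(** Polarisation: the form is real at [e_a], [e_b], [e_a + e_b] and [e_a + i e_b], which forces the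
    sum and the difference of the two off-diagonal entries to match. *)
Lemma psd_herm {C : numClosedFieldType} {I : finType} (A : mat C I I) :
  psd A -> forall a b, (A a b)^* = A b a.
Proof.
move=> pA a b.
have re v : (sesq A v v)^* = sesq A v v by apply: geC0_conj; apply: pA.
have raa := re (ket a); have rbb := re (ket b); rewrite !sesq_ket in raa rbb.
have r1 := re (fun x => ket a x + 1 * ket b x).
have ri := re (fun x => ket a x + 'i * ket b x).
rewrite !sesq_line !sesq_ket !rmorphD !rmorphM /= ?conjCK in r1 ri. rewrite raa rbb in r1 ri.
rewrite conjC1 in r1.
rewrite conjCi ?conjCK in ri.
set z := A a b in r1 ri *; set w := A b a in r1 ri *.
have e1 : z^* + w^* = z + w.
  apply/eqP; rewrite -subr_eq0; apply/eqP.
  by move/eqP: r1; rewrite -subr_eq0 => /eqP <-; ring.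
have e2 : w^* - z^* = z - w.
  apply: (mulfI (neq0Ci C)); apply/eqP; rewrite -subr_eq0; apply/eqP.
  by move/eqP: ri; rewrite -subr_eq0 => /eqP <-; ring.
apply: (mulfI (_ : 2%:R != 0 :> C)); first by rewrite pnatr_eq0.
have -> : 2%:R * z^* = (z^* + w^*) - (w^* - z^*) by ring.
by rewrite e1 e2; ring.
Qed.

Lemma psd_diag_ge0 {C : numClosedFieldType} {I : finType} (A : mat C I I) a :
  psd A -> 0 <= A a a.
Proof. by move=> pA; rewrite -sesq_ket; apply: pA. Qed.

(** With a zero diagonal entry at [a], the form on the line [e_b + c e_a] has no quadratic term in
    [c], so a nonzero [A a b] would let it become negative. *)
Lemma psd_diag_eq0 {C : numClosedFieldType} {I : finType} (A : mat C I I) a b :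
  psd A -> A a a = 0 -> A a b = 0.
Proof.
move=> pA a0; apply/eqP/negPn/negP => nz.
have Hab := psd_herm A pA a b.
have nz' : (A a b)^* != 0 by rewrite conjC_eq0.
have bge := psd_diag_ge0 A b pA.
(* This [c] makes each of the two cross terms equal to [- (A b b + 1)], so the form takes the value
   [- (A b b + 2)]. *)
pose c := - (A b b + 1) / (A a b)^*.
have c1 : c * (A a b)^* = - (A b b + 1) by rewrite /c mulfVK.
have c2 : c^* * A a b = - (A b b + 1).
  by rewrite -[A a b]conjCK -rmorphM /= c1 rmorphN rmorphD /= conjC1 geC0_conj.
have := pA (fun x => ket b x + c * ket a x).
rewrite -/(sesq _ _ _) sesq_line !sesq_ket a0 -Hab c1 c2 mulr0 addr0.
have -> : A b b - (A b b + 1) - (A b b + 1) = - (A b b + 2%:R) by ring.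
rewrite oppr_ge0 => le0.
have : 0 < A b b + 2%:R by rewrite ltr_wpDl // ltr0n.
by move/lt_geF; rewrite le0.
Qed.

(* Completing the square: the minimum of [sesq A] on the line [v + c e_o] is the form of the Schur complement at [v]. *)
Lemma psd_schur {C : numClosedFieldType} {I : finType} (A : mat C I I) o :
  psd A -> A o o != 0 -> psd (fun a b => A a b - A a o * A o b / A o o).
Proof.
move=> pA nz v.
have herm := psd_herm A pA.
pose s := \sum_b A o b * v b.
have sv : sesq A (ket o) v = s by rewrite sesq_ketl.
have sE : s^* = \sum_a (v a)^* * A a o.
  rewrite /s rmorph_sum; apply: eq_bigr => a _.
  by rewrite rmorphM /= herm mulrC.
have vs : sesq A v (ket o) = s^*.
  rewrite sE /sesq /ket; apply: eq_bigr => a _.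
  under eq_bigr => b _ do rewrite mulrC.
  by rewrite sum_delta.
have oo := geC0_conj (psd_diag_ge0 A o pA).
have := pA (fun x => v x + (- s / A o o) * ket o x).
rewrite -/(sesq _ _ _) sesq_line sv vs sesq_ket.
set l := (X in 0 <= X -> _); set r := (X in _ -> 0 <= X).
suff -> : l = r by [].
have -> : r = sesq A v v - s^* * s / A o o.
  rewrite sE /sesq /s -mulrA big_distrl -sumrB; apply: eq_bigr => a _.
  rewrite big_distrl big_distrr -sumrB /=; apply: eq_bigr => b _.
  by ring.
by rewrite /l rmorphM rmorphN /= fmorphV /= oo; field.
Qed.

(* Cholesky: each step clears one diagonal entry, and a column of [B] vanishes where the diagonal does. *)
Lemma psd_gram {C : numClosedFieldType} {I : finType} (A : mat C I I) :
  psd A -> exists B : mat C I I, forall a b, A a b = \sum_k B a k * (B b k)^*.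
Proof.
move=> pA.
suff [B [HB _]] : exists B : mat C I I,
    (forall a b, A a b = \sum_k B a k * (B b k)^*) /\
    (forall k, A k k = 0 -> forall a, B a k = 0) by exists B.
move: {2}_.+1 (ltnSn #|[pred o | A o o != 0]|) => N.
elim: N => // N IH in A pA *; rewrite ltnS => leN.
have [/existsP [o nz]|/existsPn all0] := boolP [exists o, A o o != 0]; last first.
  exists (fun _ _ => 0); split=> // a b; rewrite big1 => [|k _]; last by rewrite mul0r.
  by apply: psd_diag_eq0 => //; apply/eqP/negPn/all0.
have herm := psd_herm A pA.
pose A' a b := A a b - A a o * A o b / A o o.
have pA' : psd A' by apply: psd_schur.
have A'o : A' o o = 0 by rewrite /A' mulfK // subrr.
have A'0 a : A a a = 0 -> A' a a = 0.
  by move=> a0; rewrite /A' (psd_diag_eq0 A a o pA a0) a0 !mul0r subrr.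
have [|B [HB B0]] := IH A' pA'.
  apply: leq_trans leN; apply: proper_card; apply/properP; split.
    by apply/subsetP => a; rewrite !inE; apply: contra => /eqP /A'0 ->.
  by exists o; rewrite !inE // A'o eqxx.
(* Column [o] of the recursive factor is zero because [A' o o = 0], so it is free to carry the
   rank-one part removed from [A]. *)
exists (fun a k => if k == o then A a o / sqrtC (A o o) else B a k); split; last first.
  move=> k k0 a; case: eqP => [ko|_]; first by rewrite -ko k0 eqxx in nz.
  exact/B0/A'0.
move=> a b; rewrite (bigD1 o) //= eqxx.
have -> : A a b = A a o * A o b / A o o + A' a b by rewrite /A'; ring.
congr (_ + _).
  have so : (sqrtC (A o o))^* = sqrtC (A o o).
    by apply: geC0_conj; rewrite sqrtC_ge0 psd_diag_ge0.
  rewrite rmorphM fmorphV /= so herm mulf_div -expr2 sqrtCK //.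
rewrite HB (bigD1 o) //= (B0 o A'o) mul0r add0r.
by apply: eq_bigr => k /negPf ->.
Qed.

(** * Kraus decompositions *)

Lemma mat_ext {C : numClosedFieldType} {I J : finType} (A B : mat C I J) :
  (forall i j, A i j = B i j) -> A = B.
Proof.
by move=> AB; apply: functional_extensionality => i;
  apply: functional_extensionality.
Qed.

Lemma malg_ext {C : numClosedFieldType} {K : finType} {D : K -> finType}
  (x y : malg C D) : (forall k a b, x k a b = y k a b) -> x = y.
Proof.
by move=> xy; apply: functional_extensionality_dep => k; apply: mat_ext.
Qed.

(** The matrix unit [|p><q|] of summand [i]. Comparing tagged indices avoids a cast between [D k]
    and [D i]. *)
Definition munit {C : numClosedFieldType} {K : finType} {D : K -> finType}
  (i : K) (p q : D i) : malg C D :=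
  fun k a b => ((Tagged (fun k => D k) a == Tagged (fun k => D k) p) &&
                (Tagged (fun k => D k) b == Tagged (fun k => D k) q))%:R.

Lemma Tagged_neq {K : finType} {D : K -> finType} i k (p : D i) (a : D k) :
  k != i -> (Tagged (fun k => D k) a == Tagged (fun k => D k) p) = false.
Proof. by move=> ki; apply: contraNF ki => /eqP /(congr1 tag) /= ->. Qed.

Lemma munit_diag {C : numClosedFieldType} {K : finType} {D : K -> finType}
  (i : K) (p q a b : D i) :
  munit i p q i a b = (a == p)%:R * (b == q)%:R :> C.
Proof. by rewrite /munit !eq_Tagged /= -natrM mulnb. Qed.

Lemma munit_off {C : numClosedFieldType} {K : finType} {D : K -> finType}
  (i k : K) (p q : D i) (a b : D k) : k != i -> munit i p q k a b = 0 :> C.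
Proof. by move=> ki; rewrite /munit Tagged_neq. Qed.

Lemma sum_munit {C : numClosedFieldType} {K : finType} {D : K -> finType}
  (i : K) (p q : D i) (F : forall k, D k -> D k -> C) :
  \sum_k \sum_a \sum_b F k a b * munit i p q k a b = F i p q.
Proof.
rewrite (bigD1 i) //= [X in _ + X]big1 ?addr0 => [|k ki]; last first.
  by rewrite big1 // => a _; rewrite big1 // => b _; rewrite munit_off // mulr0.
under eq_bigr => a _ do
  (under eq_bigr => b _ do rewrite munit_diag mulrC -mulrA mulrCA).
under eq_bigr => a _ do rewrite sum_delta.
exact: sum_delta.
Qed.

Lemma malg_munit {C : numClosedFieldType} {K : finType} {D : K -> finType}
  (x : malg C D) k a b :
  x k a b = \sum_i \sum_p \sum_q x i p q * munit i p q k a b.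
Proof.
rewrite -[LHS](sum_munit k a b); apply: eq_bigr => i _; apply: eq_bigr => p _.
apply: eq_bigr => q _; congr (_ * (_ && _)%:R); exact: eq_sym.
Qed.

Lemma mlinear_lincomb {C : numClosedFieldType} {K1 K2 : finType}
  {D1 : K1 -> finType} {D2 : K2 -> finType} (f : malg C D1 -> malg C D2)
  {T : Type} (r : seq T) (c : T -> C) (X : T -> malg C D1) :
  mlinear f ->
  f (fun k a b => \sum_(t <- r) c t * X t k a b) =
  fun k a b => \sum_(t <- r) c t * f (X t) k a b.
Proof.
move=> lf; elim: r => [|t r IH].
  (* Zero is written as [(-1) 0 + 0], so that linearity yields [f 0 = - f 0 + f 0 = 0]. *)
  have e : madd (mscale (-1) (fun k a b => \sum_(t <- [::]) c t * X t k a b))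
     (fun k a b => \sum_(t <- [::]) c t * X t k a b) =
     (fun k a b => \sum_(t <- [::]) c t * X t k a b).
    by apply: malg_ext => k a b; rewrite /madd /mscale !big_nil mulr0 addr0.
  rewrite -{}e lf; apply: malg_ext => k a b.
  by rewrite /madd /mscale mulN1r addNr big_nil.
have -> : (fun k a b => \sum_(s <- t :: r) c s * X s k a b) =
   madd (mscale (c t) (X t)) (fun k a b => \sum_(s <- r) c s * X s k a b).
  by apply: malg_ext => k a b; rewrite /madd /mscale big_cons.
by rewrite lf IH; apply: malg_ext => k a b; rewrite /madd /mscale big_cons.
Qed.

Lemma mlinear_munit {C : numClosedFieldType} {K1 K2 : finType}
  {D1 : K1 -> finType} {D2 : K2 -> finType} (f : malg C D1 -> malg C D2) :
  mlinear f -> forall x j a b,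
  f x j a b = \sum_i \sum_p \sum_q x i p q * f (munit i p q) j a b.
Proof.
move=> lf x j a b.
(* The triple sum over block, row and column is flattened to one sum over [T], to which
   [mlinear_lincomb] applies. *)
pose T := {i : K1 & (D1 i * D1 i)%type}.
pose c (t : T) := x (tag t) (tagged t).1 (tagged t).2.
pose X (t : T) : malg C D1 := munit (tag t) (tagged t).1 (tagged t).2.
have sumT (F : forall i, D1 i -> D1 i -> C) :
    \sum_i \sum_p \sum_q F i p q =
    \sum_(t : T) F (tag t) (tagged t).1 (tagged t).2.
  under eq_bigr => i _ do rewrite pair_bigA /=.
  by rewrite sig_big_dep.
have {1}-> : x = fun k a b => \sum_(t : T) c t * X t k a b.
  by apply: malg_ext => k a' b'; rewrite malg_munit sumT.
by rewrite (mlinear_lincomb f _ c X lf) sumT.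
Qed.

Definition kraus {C : numClosedFieldType} {K1 K2 : finType}
  {D1 : K1 -> finType} {D2 : K2 -> finType} {F : K1 -> K2 -> finType}
  (L : forall i j, F i j -> mat C (D2 j) (D1 i)) : malg C D1 -> malg C D2 :=
  fun x j a b =>
  \sum_i \sum_(f : F i j) \sum_p \sum_q L i j f a p * x i p q * (L i j f b q)^*.

Lemma kraus_munit {C : numClosedFieldType} {K1 K2 : finType}
  {D1 : K1 -> finType} {D2 : K2 -> finType} {F : K1 -> K2 -> finType}
  (L : forall i j, F i j -> mat C (D2 j) (D1 i)) i p q j a b :
  kraus L (munit i p q) j a b = \sum_f L i j f a p * (L i j f b q)^*.
Proof.
rewrite /kraus.
under eq_bigr => k _.
  rewrite exchange_big /=.
  under eq_bigr => a' _.
    rewrite exchange_big /=.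
    under eq_bigr => b' _.
      under eq_bigr => f _ do rewrite mulrAC.
      rewrite -big_distrl /=; over.
    over.
  over.
exact: (sum_munit i p q (fun k a' b' => \sum_f L k j f a a' * (L k j f b b')^*)).
Qed.

Lemma mlinear_kraus {C : numClosedFieldType} {K1 K2 : finType}
  {D1 : K1 -> finType} {D2 : K2 -> finType} {F : K1 -> K2 -> finType}
  (L : forall i j, F i j -> mat C (D2 j) (D1 i)) : mlinear (kraus L).
Proof.
move=> c x y; apply: malg_ext => j a b; rewrite /madd /mscale /kraus.
rewrite big_distrr -big_split; apply: eq_bigr => i _ /=.
rewrite big_distrr -big_split; apply: eq_bigr => f _ /=.
rewrite big_distrr -big_split; apply: eq_bigr => p _ /=.
rewrite big_distrr -big_split; apply: eq_bigr => q _ /=.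
by ring.
Qed.

(* Choi: the Gram factors of the image of the unnormalised maximally entangled operator are Kraus operators. *)
Lemma kraus_exists {C : numClosedFieldType} {K1 K2 : finType}
  {D1 : K1 -> finType} {D2 : K2 -> finType} (f : malg C D1 -> malg C D2) :
  mlinear f -> cp f ->
  exists (F : K1 -> K2 -> finType) (L : forall i j, F i j -> mat C (D2 j) (D1 i)),
    f = kraus L.
Proof.
move=> lf cf.
(* The ancilla is an ordinal, as [cp] requires, and numbers the basis vectors of all blocks at once:
   distinct blocks get distinct labels, so slicing [x] at two labels gives a matrix unit, or zero if
   the blocks differ. *)
pose T : finType := {i : K1 & D1 i}.
pose rk i (p : D1 i) : 'I_#|T| := enum_rank (Tagged (fun i => D1 i) p : T).
pose x : malg C (prodD D1 'I_#|T|) := fun k a b =>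
  (a.2 == rk k a.1)%:R * (b.2 == rk k b.1)%:R.
have px : mpos x.
  move=> k v.
  pose s := \sum_(a : D1 k * 'I_#|T|) (a.2 == rk k a.1)%:R * v a.
  have -> : \sum_a \sum_b (v a)^* * x k a b * v b = s^* * s.
    rewrite /s rmorph_sum /= big_distrl; apply: eq_bigr => a _.
    rewrite big_distrr; apply: eq_bigr => b _ /=.
    by rewrite rmorphM /= conjC_nat /x; ring.
  by rewrite mulrC mul_conjC_ge0.
have fx k i p q a b :
    ampl 'I_#|T| f x k (a, rk i p) (b, rk i q) = f (munit i p q) k a b.
  rewrite /ampl /=; congr (f _ k a b); apply: malg_ext => k' a' b'.
  rewrite /x /munit /= -natrM mulnb.
  by rewrite ![_ == rk k' _]eq_sym !(inj_eq enum_rank_inj).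
have /fin_all_exists [B HB] : forall k, exists B : mat C (D2 k * 'I_#|T|) (D2 k * 'I_#|T|),
    forall a b, ampl 'I_#|T| f x k a b = \sum_l B a l * (B b l)^*.
  by move=> k; apply: psd_gram; apply: cf.
(* Column [l] of the Gram factor is reshaped into an operator: the ancilla label [rk i p] becomes
   the input index. *)
exists (fun i j => (D2 j * 'I_#|T|)%type), (fun i j l a p => B j (a, rk i p) l).
apply: functional_extensionality => y; apply: malg_ext => j a b.
rewrite (mlinear_munit f lf) (mlinear_munit _ (mlinear_kraus _)).
apply: eq_bigr => i _; apply: eq_bigr => p _; apply: eq_bigr => q _.
by rewrite -fx HB kraus_munit.
Qed.

Lemma exchange_big3 {R : nmodType} {I K : finType} {J : I -> finType}
  (F : forall i, J i -> K -> R) :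
  \sum_i \sum_j \sum_k F i j k = \sum_k \sum_i \sum_j F i j k.
Proof.
rewrite [RHS]exchange_big /=; apply: eq_bigr => i _; exact: exchange_big.
Qed.

Lemma sum_prod {R : nmodType} {I J : finType} (F : I * J -> R) :
  \sum_p F p = \sum_i \sum_j F (i, j).
Proof. by rewrite pair_bigA; apply: eq_bigr => -[]. Qed.

(** The form of the output at [v] is the sum over [i] and [f] of the forms of [x i] at the
    pulled-back vectors [w i f = (L_f^* (x) 1) v]. *)
Lemma cp_kraus {C : numClosedFieldType} {K1 K2 : finType}
  {D1 : K1 -> finType} {D2 : K2 -> finType} {F : K1 -> K2 -> finType}
  (L : forall i j, F i j -> mat C (D2 j) (D1 i)) : cp (kraus L).
Proof.
move=> n x px j v.
pose w i f (c : D1 i * 'I_n) := \sum_b (L i j f b c.1)^* * v (b, c.2).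
have -> : \sum_a \sum_b (v a)^* * ampl 'I_n (kraus L) x j a b * v b =
  \sum_i \sum_f \sum_c \sum_d (w i f c)^* * x i c d * w i f d; last first.
  by apply: sumr_ge0 => i _; apply: sumr_ge0 => f _; apply: px.
transitivity (\sum_i \sum_f \sum_a \sum_b \sum_p \sum_q
    (v a)^* * (L i j f a.1 p * x i (p, a.2) (q, b.2) * (L i j f b.1 q)^*) * v b).
  transitivity (\sum_a \sum_b \sum_i \sum_f \sum_p \sum_q
    (v a)^* * (L i j f a.1 p * x i (p, a.2) (q, b.2) * (L i j f b.1 q)^*) * v b).
    apply: eq_bigr => a _; apply: eq_bigr => b _.
    rewrite /ampl /kraus.
    do 4![rewrite big_distrr big_distrl /=; apply: eq_bigr => ? _].
    by [].
  by rewrite exchange_big3; apply: eq_bigr => i _; rewrite exchange_big3.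
apply: eq_bigr => i _; apply: eq_bigr => f _.
transitivity (\sum_p \sum_s \sum_q \sum_t \sum_a \sum_b
  (v (a, s))^* * (L i j f a p * x i (p, s) (q, t) * (L i j f b q)^*) * v (b, t)).
  rewrite sum_prod.
  under eq_bigr => a _ do (under eq_bigr => u _ do rewrite exchange_big).
  rewrite exchange_big3; apply: eq_bigr => p _ /=.
  rewrite exchange_big; apply: eq_bigr => u _ /=.
  under eq_bigr => a _ do rewrite sum_prod exchange_big3.
  rewrite exchange_big; apply: eq_bigr => q _ /=.
  under eq_bigr => a _ do rewrite exchange_big.
  by rewrite exchange_big.
rewrite [RHS]sum_prod; apply: eq_bigr => p _; apply: eq_bigr => u _.
rewrite [RHS]sum_prod; apply: eq_bigr => q _; apply: eq_bigr => t _.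
rewrite /w rmorph_sum /= -mulrA big_distrl; apply: eq_bigr => a _.
rewrite !big_distrr; apply: eq_bigr => b _ /=.
by rewrite rmorphM /= conjCK; ring.
Qed.

(** By cyclicity the trace sees the family only through the sums of [L_f^* L_f]; testing on matrix
    units then turns trace preservation into the isometry relation of [kraus_tpP]. *)
Lemma mtrace_kraus {C : numClosedFieldType} {K1 K2 : finType}
  {D1 : K1 -> finType} {D2 : K2 -> finType} {F : K1 -> K2 -> finType}
  (L : forall i j, F i j -> mat C (D2 j) (D1 i)) x :
  mtrace (kraus L x) = \sum_i \sum_p \sum_q
    (\sum_j \sum_f \sum_a (L i j f a q)^* * L i j f a p) * x i p q.
Proof.
rewrite /mtrace /kraus exchange_big3; apply: eq_bigr => i _.
transitivity (\sum_j \sum_p \sum_q \sum_f \sum_a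
    (L i j f a q)^* * L i j f a p * x i p q).
  apply: eq_bigr => j _; rewrite exchange_big exchange_big3; apply: eq_bigr => p _.
  rewrite exchange_big3; apply: eq_bigr => q _; apply: eq_bigr => f _.
  by apply: eq_bigr => a _; ring.
rewrite exchange_big; apply: eq_bigr => p _.
rewrite exchange_big; apply: eq_bigr => q _ /=.
by do 3![rewrite big_distrl /=; apply: eq_bigr => ? _].
Qed.

Lemma mtraceE {C : numClosedFieldType} {K : finType} {D : K -> finType}
  (x : malg C D) : mtrace x = \sum_i \sum_p \sum_q (p == q)%:R * x i p q.
Proof.
apply: eq_bigr => i _; apply: eq_bigr => p _.
by under eq_bigr => q _ do rewrite eq_sym; rewrite sum_delta.
Qed.

Lemma kraus_tpP {C : numClosedFieldType} {K1 K2 : finType}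
  {D1 : K1 -> finType} {D2 : K2 -> finType} {F : K1 -> K2 -> finType}
  (L : forall i j, F i j -> mat C (D2 j) (D1 i)) :
  (forall x, mtrace (kraus L x) = mtrace x) <->
  (forall i p q, \sum_j \sum_f \sum_a (L i j f a p)^* * L i j f a q = (p == q)%:R).
Proof.
split=> [tp i p q|iso x].
  by have := tp (munit i q p); rewrite mtrace_kraus mtraceE !sum_munit eq_sym.
rewrite mtrace_kraus mtraceE; apply: eq_bigr => i _; apply: eq_bigr => p _.
by apply: eq_bigr => q _; rewrite iso eq_sym.
Qed.

(** * Composition through the maximally entangled state *)

Lemma sum_norm_eq0 {C : numClosedFieldType} {T : finType} (g : T -> C) :
  \sum_t g t * (g t)^* = 0 -> forall t, g t = 0.
Proof.
move=> s0 t; apply/eqP; rewrite -mul_conjC_eq0; apply/eqP.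
by apply: (psumr_eq0P _ s0) => // t' _; apply: mul_conjC_ge0.
Qed.

(** For fixed blocks, regard the entries [G i j t a p] as vectors indexed by [t]. Their inner
    products are read off from the values on matrix units: off-diagonal vectors have norm zero, and
    so do differences of diagonal ones. *)
Lemma kraus_scalar {C : numClosedFieldType} {K : finType} {D : K -> finType}
  {T : K -> K -> finType} (G : forall i j, T i j -> mat C (D j) (D i)) (c : C) :
  (forall x, kraus G x = mscale c x) ->
  (forall i j t a p, i != j -> G i j t a p = 0) /\
  (forall i t a p q, G i i t a p = (a == p)%:R * G i i t q q).
Proof.
move=> Gc.
have GG i p q j a b :
    \sum_t G i j t a p * (G i j t b q)^* = c * munit i p q j a b.
  by rewrite -kraus_munit Gc.
split=> [i j t a p ij|i t a p q].
  apply: (sum_norm_eq0 (fun t => G i j t a p)).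
  by rewrite GG munit_off ?mulr0 // eq_sym.
have [->|ap] := eqVneq a p; last first.
  rewrite mul0r; apply: (sum_norm_eq0 (fun t => G i i t a p)).
  by rewrite GG munit_diag (negPf ap) mul0r mulr0.
rewrite mul1r; apply/eqP; rewrite -subr_eq0; apply/eqP.
apply: (sum_norm_eq0 (fun t => G i i t p p - G i i t q q)).
transitivity (\sum_t G i i t p p * (G i i t p p)^* - \sum_t G i i t p p * (G i i t q q)^*
  - (\sum_t G i i t q q * (G i i t p p)^* - \sum_t G i i t q q * (G i i t q q)^*)).
  by rewrite -!sumrB; apply: eq_bigr => s _; rewrite rmorphB /=; ring.
by rewrite !GG !munit_diag !eqxx !mulr1 subrr.
Qed.

(** [kraus] with the source family fixed as [prodD DA H], which agrees with [DA i * H] only up to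
    conversion. *)
Definition krausH {C : numClosedFieldType} {KA KB : finType}
  {DA : KA -> finType} {DB : KB -> finType} {H : finType} {E : KA -> KB -> finType}
  (K : forall i j, E i j -> mat C (DB j) (DA i * H)) :
  malg C (prodD DA H) -> malg C DB := @kraus C KA KB (prodD DA H) DB E K.

Section Composition.
Context {C : numClosedFieldType} {KA KB : finType}.
Context {DA : KA -> finType} {DB : KB -> finType} {H : finType}.
Context {E : KA -> KB -> finType} {F : KB -> KA -> finType}.
Variable K : forall i j, E i j -> mat C (DB j) (DA i * H).
Variable L : forall j i, F j i -> mat C (DA i) (DB j * H).

(* The Kraus operators of [rho |-> L ((K (x) id) (rho (x) |eta><eta|))]. *)
Definition kcomp i i' j (f : F j i') (e : E i j) : mat C (DA i') (DA i) :=
  fun x a => \sum_P L j i' f x P * K i j e P.1 (a, P.2).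

(** The deltas of [maxent] identify the input leg [H] of [K_e] with the untouched second leg,
    bending the former into an output index. *)
Lemma ampl_krausH_maxent rho j P Q :
  ampl H (krausH K) (mtens rho (maxent C H)) j P Q =
  #|H|%:R^-1 * \sum_i \sum_(e : E i j) \sum_a \sum_b
     K i j e P.1 (a, P.2) * rho i a b * (K i j e Q.1 (b, Q.2))^*.
Proof.
rewrite /ampl /krausH /kraus big_distrr; apply: eq_bigr => i _ /=.
rewrite big_distrr; apply: eq_bigr => e _ /=.
rewrite big_distrr sum_prod; apply: eq_bigr => a _ /=.
under eq_bigr => h _.
  rewrite sum_prod.
  under eq_bigr => b _.
    rewrite (_ : \sum_(h' : H) _ = (h == P.2)%:R * (#|H|%:R^-1 *
      (K i j e P.1 (a, h) * rho i a b * (K i j e Q.1 (b, Q.2))^*))).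
      over.
    rewrite -[RHS](sum_delta Q.2 (fun h' => (h == P.2)%:R * (#|H|%:R^-1 *
      (K i j e P.1 (a, h) * rho i a b * (K i j e Q.1 (b, h'))^*)))).
    apply: eq_bigr => h' _; rewrite /mtens /maxent /= -mulnb natrM; ring.
  rewrite -big_distrr /=; over.
by rewrite sum_delta big_distrr.
Qed.

(** The intermediate block [j] becomes part of the Kraus label. *)
Definition kcomp_sig i i' (t : {j : KB & (F j i' * E i j)%type}) :
  mat C (DA i') (DA i) := kcomp i i' (tag t) (tagged t).1 (tagged t).2.

Lemma krausH_comp rho :
  krausH L (ampl H (krausH K) (mtens rho (maxent C H))) =
  mscale #|H|%:R^-1 (kraus kcomp_sig rho).
Proof.
apply: malg_ext => i' x x'; rewrite /mscale {1}/krausH {1}/kraus.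
transitivity (\sum_j \sum_(f : F j i') \sum_P \sum_Q \sum_i
   \sum_(e : E i j) \sum_a \sum_b #|H|%:R^-1 *
     (L j i' f x P * (K i j e P.1 (a, P.2) * rho i a b * (K i j e Q.1 (b, Q.2))^*) *
     (L j i' f x' Q)^*)).
  do 4![apply: eq_bigr => ? _].
  rewrite ampl_krausH_maxent (_ : forall u v w z : C, u * (v * w) * z = (v * u * z) * w); last first.
    by move=> *; ring.
  by do 4![rewrite big_distrr; apply: eq_bigr => ? _ /=]; ring.
rewrite big_distrr /=.
under eq_bigr => j _ do (under eq_bigr => f _ do rewrite exchange_big3).
rewrite exchange_big3; apply: eq_bigr => i _.
rewrite big_distrr -(sig_big_dep (fun _ => true) (fun _ _ => true) (fun j fe => #|H|%:R^-1 *
  \sum_a \sum_b kcomp i i' j fe.1 fe.2 x a * rho i a b * (kcomp i i' j fe.1 fe.2 x' b)^*)) /=.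
apply: eq_bigr => j _; rewrite sum_prod; apply: eq_bigr => f _ /=.
rewrite exchange_big3; apply: eq_bigr => e _.
rewrite exchange_big3 big_distrr; apply: eq_bigr => a _ /=.
rewrite exchange_big3 big_distrr; apply: eq_bigr => b _ /=.
rewrite /kcomp rmorph_sum /= !big_distrl big_distrr; apply: eq_bigr => P _ /=.
rewrite !big_distrr; apply: eq_bigr => Q _ /=.
by rewrite rmorphM /=; ring.
Qed.

End Composition.

(** * Scalar composites and the traces that determine them *)

Definition ktrace {C : numClosedFieldType} {KA KB : finType}
  {DA : KA -> finType} {DB : KB -> finType} {H : finType}
  {E : KA -> KB -> finType} {F : KB -> KA -> finType}
  (K : forall i j, E i j -> mat C (DB j) (DA i * H))
  (L : forall j i, F j i -> mat C (DA i) (DB j * H)) i j (f : F j i) (e : E i j) : C :=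
  \sum_x kcomp K L i i j f e x x.

(** Cyclicity of the trace, which ties the scalars of the two orders of composition to a single
    number. *)
Lemma ktraceC {C : numClosedFieldType} {KA KB : finType}
  {DA : KA -> finType} {DB : KB -> finType} {H : finType}
  {E : KA -> KB -> finType} {F : KB -> KA -> finType}
  (K : forall i j, E i j -> mat C (DB j) (DA i * H))
  (L : forall j i, F j i -> mat C (DA i) (DB j * H)) i j f e :
  ktrace K L i j f e = ktrace L K j i e f.
Proof.
rewrite /ktrace /kcomp.
under eq_bigr => x _ do rewrite sum_prod.
under [RHS]eq_bigr => y _ do rewrite sum_prod.
rewrite exchange_big; apply: eq_bigr => y _; apply: eq_bigr => x _.
by apply: eq_bigr => h _; rewrite mulrC.
Qed.

(** The scalar is expressed as trace over dimension so that [ktraceC] can compare the two orders. *)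
Definition kcomp_scalar {C : numClosedFieldType} {KA KB : finType}
  {DA : KA -> finType} {DB : KB -> finType} {H : finType}
  {E : KA -> KB -> finType} {F : KB -> KA -> finType}
  (K : forall i j, E i j -> mat C (DB j) (DA i * H))
  (L : forall j i, F j i -> mat C (DA i) (DB j * H)) :=
  (forall i i' j f e x a, i != i' -> kcomp K L i i' j f e x a = 0) /\
  (forall i j f e x a,
     kcomp K L i i j f e x a = (x == a)%:R * (ktrace K L i j f e / #|DA i|%:R)).

Lemma krausH_inverse_scalar {C : numClosedFieldType} {KA KB : finType}
  {DA : KA -> finType} {DB : KB -> finType} {H : finType}
  {E : KA -> KB -> finType} {F : KB -> KA -> finType}
  (K : forall i j, E i j -> mat C (DB j) (DA i * H))
  (L : forall j i, F j i -> mat C (DA i) (DB j * H)) :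
  (forall i, 0 < #|DA i|)%N -> (0 < #|H|)%N ->
  (forall rho, krausH L (ampl H (krausH K) (mtens rho (maxent C H))) = rho) ->
  kcomp_scalar K L.
Proof.
move=> A0 H0 inv.
have Hn0 : #|H|%:R != 0 :> C by rewrite pnatr_eq0 -lt0n.
(* The constant [#|H|] undoes the normalisation of [maxent]. *)
have [rho|off diag] := kraus_scalar (kcomp_sig K L) #|H|%:R.
  apply: malg_ext => i a b; rewrite /mscale -{2}(inv rho) krausH_comp /mscale.
  by rewrite mulVKf.
split=> [i i' j f e x a ii'|i j f e x a].
  exact: (off i i' (Tagged (fun j => (F j i' * E i j)%type) (f, e))).
rewrite /ktrace (eq_bigr (fun=> kcomp K L i i j f e x x)) => [|y _]; last first.
  etransitivity; first exact: (diag i (Tagged (fun j => (F j i * E i j)%type) (f, e)) y y x).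
  by rewrite eqxx mul1r.
rewrite sumr_const -[_ *+ #|_|]mulr_natr mulfK ?pnatr_eq0 -?lt0n //.
exact: (diag i (Tagged (fun j => (F j i * E i j)%type) (f, e)) x a x).
Qed.

(* [kiso] and [kcoiso] say [U_i^* U_i = 1] and [U_i U_i^* = 1]; [tiso] and [tcoiso] say
   [W_j^* W_j = 1] and [W_j W_j^* = 1], with a nonzero weight cancelled off the diagonal. *)
Definition kiso {C : numClosedFieldType} {KA KB : finType}
  {DA : KA -> finType} {DB : KB -> finType} {H : finType}
  {E : KA -> KB -> finType}
  (K : forall i j, E i j -> mat C (DB j) (DA i * H)) :=
  forall i p q, \sum_j \sum_e \sum_y (K i j e y p)^* * K i j e y q = (p == q)%:R.

(* The composite being scalar reads [U_i L~ = 1 (x) mu] for the isometry [U_i] built from [K], so [L~ = U_i^* (1 (x) mu)]. *)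
Lemma kraus_factor {C : numClosedFieldType} {KA KB : finType}
  {DA : KA -> finType} {DB : KB -> finType} {H : finType}
  {E : KA -> KB -> finType} {F : KB -> KA -> finType}
  (K : forall i j, E i j -> mat C (DB j) (DA i * H))
  (L : forall j i, F j i -> mat C (DA i) (DB j * H)) :
  kiso K -> kcomp_scalar L K -> forall i j f x P,
  L j i f x P =
  \sum_e ktrace K L i j f e / #|DB j|%:R * (K i j e P.1 (x, P.2))^*.
Proof.
move=> iso [off diag] i j f x [b h] /=.
(* The relation [U_i^* U_i = 1] is inserted in front of [L]; the inner sums are then composites, and
   only [j' = j] survives. *)
transitivity (\sum_j' \sum_e \sum_y (K i j' e y (x, h))^* * kcomp L K j j' i e f y b).
  rewrite -[LHS](sum_delta (x, h) (fun Q => L j i f Q.1 (b, Q.2))).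
  under eq_bigr => Q _ do rewrite eq_sym -iso big_distrl.
  rewrite exchange_big; apply: eq_bigr => j' _ /=.
  under eq_bigr => Q _ do rewrite big_distrl.
  rewrite exchange_big; apply: eq_bigr => e _ /=.
  under eq_bigr => Q _ do rewrite big_distrl.
  rewrite exchange_big; apply: eq_bigr => y _ /=.
  by rewrite /kcomp big_distrr; apply: eq_bigr => Q _ /=; rewrite mulrA.
rewrite (bigD1 j) //= [X in _ + X]big1 ?addr0 => [|j' jj']; last first.
  rewrite big1 // => e _; rewrite big1 // => y _.
  by rewrite off ?mulr0 // eq_sym.
apply: eq_bigr => e _; rewrite ktraceC.
under eq_bigr => y _ do rewrite diag mulrCA.
by rewrite sum_delta mulrC.
Qed.

(** Minimality of the dilation: linear independence of the Kraus operators within each pair of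
    blocks. *)
Definition kfree {C : numClosedFieldType} {KA KB : finType}
  {DA : KA -> finType} {DB : KB -> finType} {H : finType}
  {E : KA -> KB -> finType}
  (K : forall i j, E i j -> mat C (DB j) (DA i * H)) :=
  forall i j (c : E i j -> C),
    (forall y a, \sum_e c e * K i j e y a = 0) -> forall e, c e = 0.

(** Substituting the factorisation of [L] by [K] into that of [K] by [L] writes [K_e] as a
    combination of the [K_e']. By linear independence its coefficients are Kronecker deltas; [c] is
    their defect. *)
Lemma ktrace_unitary {C : numClosedFieldType} {KA KB : finType}
  {DA : KA -> finType} {DB : KB -> finType} {H : finType}
  {E : KA -> KB -> finType} {F : KB -> KA -> finType}
  (K : forall i j, E i j -> mat C (DB j) (DA i * H))
  (L : forall j i, F j i -> mat C (DA i) (DB j * H)) :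
  (forall i, 0 < #|DA i|)%N -> (forall j, 0 < #|DB j|)%N ->
  kiso K -> kiso L -> kcomp_scalar K L -> kcomp_scalar L K -> kfree K ->
  forall i j e e',
  \sum_f ktrace K L i j f e * (ktrace K L i j f e')^* =
  (e == e')%:R * #|DA i|%:R * #|DB j|%:R.
Proof.
move=> A0 B0 isoK isoL KL LK free i j e e'.
set a := #|DA i|%:R; set b := #|DB j|%:R.
have an0 : a != 0 by rewrite pnatr_eq0 -lt0n.
have bn0 : b != 0 by rewrite pnatr_eq0 -lt0n.
pose c e' := (\sum_f ktrace K L i j f e * (ktrace K L i j f e')^*) / a / b - (e' == e)%:R.
suff : c e' = 0.
  move/eqP; rewrite subr_eq0 [e == e']eq_sym => /eqP <-.
  by rewrite mulrAC !divfK.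
apply: free => y p; rewrite /c.
under eq_bigr => e1 _ do rewrite mulrBl.
rewrite sumrB sum_delta; apply/eqP; rewrite subr_eq0; apply/eqP.
case: p => x h; rewrite (kraus_factor L K isoL KL) /=.
under eq_bigr => e1 _ do rewrite -!mulrA big_distrl.
rewrite exchange_big; apply: eq_bigr => f _ /=.
rewrite (kraus_factor K L isoK LK) rmorph_sum big_distrr.
apply: eq_bigr => e1 _ /=.
by rewrite !rmorphM /= fmorphV /= conjC_nat conjCK -ktraceC -/a -/b; ring.
Qed.

(** * Unitarity from invertibility *)

Definition kcoiso {C : numClosedFieldType} {KA KB : finType}
  {DA : KA -> finType} {DB : KB -> finType} {H : finType}
  {E : KA -> KB -> finType}
  (K : forall i j, E i j -> mat C (DB j) (DA i * H)) :=
  (forall i j j' e e' y y', j != j' ->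
     \sum_Q K i j e y Q * (K i j' e' y' Q)^* = 0) /\
  (forall i j e e' y y',
     \sum_Q K i j e y Q * (K i j e' y' Q)^* = ((e == e') && (y == y'))%:R).

Definition tiso {C : numClosedFieldType} {KA KB : finType}
  {DA : KA -> finType} {DB : KB -> finType} {H : finType}
  {E : KA -> KB -> finType}
  (K : forall i j, E i j -> mat C (DB j) (DA i * H)) :=
  (forall i i' j e e' x x', i != i' ->
     \sum_P (K i j e P.1 (x, P.2))^* * K i' j e' P.1 (x', P.2) = 0) /\
  (forall i j e e' x x',
     #|DA i|%:R / #|DB j|%:R * \sum_P (K i j e P.1 (x, P.2))^* * K i j e' P.1 (x', P.2) =
     ((x == x') && (e == e'))%:R).

Definition tcoiso {C : numClosedFieldType} {KA KB : finType}
  {DA : KA -> finType} {DB : KB -> finType} {H : finType}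
  {E : KA -> KB -> finType}
  (K : forall i j, E i j -> mat C (DB j) (DA i * H)) :=
  forall j P Q, \sum_i #|DA i|%:R / #|DB j|%:R *
     \sum_x \sum_e K i j e P.1 (x, P.2) * (K i j e Q.1 (x, Q.2))^* = (P == Q)%:R.

(** As [t^* t = n], a relation indexed by [f] can be solved for the unknowns [S e]. *)
Lemma coef_inv {C : numClosedFieldType} {T I : finType} (t : T -> I -> C) (n : C)
  (S : I -> C) :
  (forall e e', \sum_f t f e * (t f e')^* = (e == e')%:R * n) ->
  forall e', n * S e' = \sum_f (t f e')^* * \sum_e t f e * S e.
Proof.
move=> tt e'; rewrite -(sum_delta e' (fun e => n * S e)).
under [RHS]eq_bigr => f _ do rewrite big_distrr.
rewrite exchange_big; apply: eq_bigr => e _ /=.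
rewrite mulrA -tt big_distrl; apply: eq_bigr => f _ /=; ring.
Qed.

Section Inverse.
Context {C : numClosedFieldType} {KA KB : finType}.
Context {DA : KA -> finType} {DB : KB -> finType} {H : finType}.
Context {E : KA -> KB -> finType} {F : KB -> KA -> finType}.
Variable K : forall i j, E i j -> mat C (DB j) (DA i * H).
Variable L : forall j i, F j i -> mat C (DA i) (DB j * H).
Hypothesis A0 : forall i, (0 < #|DA i|)%N.
Hypothesis B0 : forall j, (0 < #|DB j|)%N.
Hypothesis isoK : kiso K.
Hypothesis isoL : kiso L.
Hypothesis KL : kcomp_scalar K L.
Hypothesis LK : kcomp_scalar L K.
Hypothesis free : kfree K.

Let a i : C := #|DA i|%:R.
Let b j : C := #|DB j|%:R.
Let t i j f e := ktrace K L i j f e.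
Let an0 i : a i != 0. Proof. by rewrite pnatr_eq0 -lt0n. Qed.
Let bn0 j : b j != 0. Proof. by rewrite pnatr_eq0 -lt0n. Qed.

Let tt i j e e' : \sum_f t i j f e * (t i j f e')^* = (e == e')%:R * (a i * b j).
Proof. by rewrite mulrA; apply: ktrace_unitary. Qed.

Let fac i j f x P : L j i f x P =
  (b j)^-1 * \sum_e t i j f e * (K i j e P.1 (x, P.2))^*.
Proof.
rewrite (kraus_factor K L isoK LK) big_distrr; apply: eq_bigr => e _ /=.
by rewrite mulrA [_^-1 * _]mulrC.
Qed.

(** Unitary freedom of Kraus families: [L] is [t / dim Y_j] applied to the bent adjoints of [K], and
    [t^* t = dim X_i dim Y_j] leaves the weight [dim X_i / dim Y_j]. *)
Lemma inverse_kraus_gram i j x x' P Q :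
  \sum_f L j i f x P * (L j i f x' Q)^* =
  #|DA i|%:R / #|DB j|%:R *
  \sum_e (K i j e P.1 (x, P.2))^* * K i j e Q.1 (x', Q.2).
Proof.
apply: (mulfI (bn0 j)); apply: (mulfI (bn0 j)).
transitivity (\sum_e K i j e Q.1 (x', Q.2) * (a i * b j * (K i j e P.1 (x, P.2))^*)).
  under [RHS]eq_bigr => e _ do
    rewrite (coef_inv (t i j) (a i * b j) (fun e => (K i j e P.1 (x, P.2))^*) (tt i j)).
  under [RHS]eq_bigr => e _ do rewrite big_distrr.
  rewrite exchange_big !big_distrr; apply: eq_bigr => f _ /=.
  rewrite !fac rmorphM fmorphV /= conjC_nat rmorph_sum /=.
  set s := \sum_e _ * _.
  under [RHS]eq_bigr => e _ do rewrite mulrA.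
  rewrite -big_distrl /=.
  have -> : \sum_e K i j e Q.1 (x', Q.2) * (t i j f e)^* =
     \sum_e (t i j f e * (K i j e Q.1 (x', Q.2))^*)^*.
    by apply: eq_bigr => e _; rewrite rmorphM /= conjCK mulrC.
  set r := \sum_e _.
  by rewrite -/(b j); field; exact: bn0.
rewrite !big_distrr; apply: eq_bigr => e _ /=.
by rewrite -/(a i) -/(b j); field; exact: bn0.
Qed.

(** With [L] factored, the relation [LK] says that [t] applied to the inner products of rows of
    [U_i] is zero or a delta times [t]; [coef_inv] cancels [t]. *)
Lemma inverse_kcoiso : kcoiso K.
Proof.
have eqn i j j' e' y' y f : kcomp L K j j' i e' f y' y =
    (b j)^-1 * \sum_e t i j f e * \sum_Q K i j' e' y' Q * (K i j e y Q)^*.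
  rewrite /kcomp.
  under eq_bigr => Q _ do rewrite fac mulrCA.
  rewrite -big_distrr; congr (_ * _) => /=.
  under eq_bigr => Q _ do rewrite big_distrr.
  rewrite exchange_big; apply: eq_bigr => e _ /=.
  by rewrite big_distrr; apply: eq_bigr => -[x h] _ /=; rewrite mulrCA.
have [off diag] := LK.
split=> [i j j' e e' y y' jj'|i j e e' y y'].
  apply: (mulfI (mulf_neq0 (an0 i) (bn0 j'))); rewrite mulr0.
  rewrite (coef_inv (t i j') _ (fun e' => \sum_Q K i j e y Q * (K i j' e' y' Q)^*) (tt i j')).
  rewrite big1 // => f _; apply/eqP; rewrite mulf_eq0; apply/orP; right.
  have := off j' j i e f y y'; rewrite eqn eq_sym jj' => /(_ isT) /eqP.
  by rewrite mulf_eq0 invr_eq0 (negPf (bn0 _)).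
apply: (mulfI (mulf_neq0 (an0 i) (bn0 j))).
rewrite (coef_inv (t i j) _ (fun e' => \sum_Q K i j e y Q * (K i j e' y' Q)^*) (tt i j)).
transitivity (\sum_f (y == y')%:R * (t i j f e * (t i j f e')^*)).
  apply: eq_bigr => f _; have := diag j i e f y y'; rewrite eqn -ktraceC -/(t i j f e) -/(b j).
  rewrite [_ / b j]mulrC mulrCA => /(mulfI (invr_neq0 (bn0 j))) ->.
  ring.
rewrite -big_distrr /= tt -mulnb natrM; ring.
Qed.

(** The same cancellation in the relation [KL]. Its scalar has denominator [dim X_i] while the
    factorisation has [dim Y_j], hence the weight. *)
Lemma inverse_tiso : tiso K.
Proof.
have eqn i i' j f e x' x : kcomp K L i i' j f e x' x =
    (b j)^-1 * \sum_e' t i' j f e' * \sum_P (K i' j e' P.1 (x', P.2))^* * K i j e P.1 (x, P.2).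
  rewrite /kcomp.
  under eq_bigr => Q _ do rewrite fac -mulrA.
  rewrite -big_distrr; congr (_ * _) => /=.
  under eq_bigr => Q _ do rewrite big_distrl.
  rewrite exchange_big; apply: eq_bigr => e' _ /=.
  by rewrite big_distrr; apply: eq_bigr => P _ /=; rewrite mulrA.
have [off diag] := KL.
split=> [i i' j e e' x x' ii'|i j e e' x x'].
  apply: (mulfI (mulf_neq0 (an0 i) (bn0 j))); rewrite mulr0.
  rewrite (coef_inv (t i j) _ (fun e => \sum_P (K i j e P.1 (x, P.2))^* * K i' j e' P.1 (x', P.2)) (tt i j)).
  rewrite big1 // => f _; apply/eqP; rewrite mulf_eq0; apply/orP; right.
  have := off i' i j f e' x x'; rewrite eqn eq_sym ii' => /(_ isT) /eqP.
  by rewrite mulf_eq0 invr_eq0 (negPf (bn0 _)).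
rewrite -/(a i) -/(b j); apply: (mulfI (mulf_neq0 (bn0 j) (bn0 j))).
set S := \sum_P _.
have -> : b j * b j * (a i / b j * S) = a i * b j * S by field; exact: bn0.
rewrite /S.
rewrite (coef_inv (t i j) _ (fun e => \sum_P (K i j e P.1 (x, P.2))^* * K i j e' P.1 (x', P.2)) (tt i j)).
transitivity (\sum_f (x == x')%:R * b j / a i * (t i j f e' * (t i j f e)^*)).
  apply: eq_bigr => f _.
  have := diag i j f e' x x'; rewrite eqn -/(t i j f e') -/(a i).
  move/(congr1 (fun z => b j * z)); rewrite mulVKf // => ->.
  by ring.
rewrite -big_distrr /= tt -mulnb natrM [e' == e]eq_sym; field; exact: an0.
Qed.

(** This is trace preservation of the inverse, with its Gram sums rewritten in terms of [K]. *)
Lemma inverse_tcoiso : tcoiso K.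
Proof.
move=> j P Q; rewrite -isoL; apply: eq_bigr => i _.
rewrite [RHS]exchange_big big_distrr; apply: eq_bigr => x _ /=.
under [RHS]eq_bigr => f _ do rewrite mulrC.
rewrite inverse_kraus_gram; congr (_ * _); apply: eq_bigr => e _.
by rewrite mulrC.
Qed.

(** The channel depends on [L] only through Gram sums over [f], which [K] determines; this is the
    source of uniqueness. *)
Lemma inverse_krausE rho i x x' :
  krausH L rho i x x' = \sum_j #|DA i|%:R / #|DB j|%:R * \sum_e \sum_P \sum_Q
     (K i j e P.1 (x, P.2))^* * rho j P Q * K i j e Q.1 (x', Q.2).
Proof.
apply: eq_bigr => j _; rewrite exchange_big [in RHS]exchange_big big_distrr.
apply: eq_bigr => P _ /=; rewrite exchange_big [in RHS]exchange_big big_distrr.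
apply: eq_bigr => Q _ /=.
under eq_bigr => f _ do rewrite mulrAC.
rewrite -big_distrl /= inverse_kraus_gram -[LHS]mulrA; congr (_ * _).
by rewrite big_distrl; apply: eq_bigr => e _ /=; rewrite mulrAC.
Qed.
End Inverse.

(** * Invertibility from unitarity *)

Lemma sum_sig {R : nmodType} {I : finType} {J : I -> finType}
  (G : {i : I & J i} -> R) :
  \sum_p G p = \sum_i \sum_(j : J i) G (Tagged (fun i => J i) j).
Proof. by rewrite sig_big_dep; apply: eq_bigr => -[]. Qed.

(** The composite has Kraus operators [c i j] times the identity for [f = e] and zero otherwise, so
    it multiplies block [i] by a number that [norm] makes equal to 1. *)
Lemma krausH_inverse {C : numClosedFieldType} {KA KB : finType}
  {DA : KA -> finType} {DB : KB -> finType} {H : finType}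
  {E : KA -> KB -> finType}
  (K : forall i j, E i j -> mat C (DB j) (DA i * H))
  (L : forall j i, E i j -> mat C (DA i) (DB j * H)) (c : KA -> KB -> C) :
  (0 < #|H|)%N ->
  (forall i i' j (f : E i' j) (e : E i j) x a, i != i' ->
     kcomp K L i i' j f e x a = 0) ->
  (forall i j (f e : E i j) x a,
     kcomp K L i i j f e x a = ((x == a) && (f == e))%:R * c i j) ->
  (forall i, \sum_j #|E i j|%:R * (c i j * (c i j)^*) = #|H|%:R) ->
  forall rho, krausH L (ampl H (krausH K) (mtens rho (maxent C H))) = rho.
Proof.
move=> H0 off diag norm rho; rewrite krausH_comp.
have Hn0 : #|H|%:R != 0 :> C by rewrite pnatr_eq0 -lt0n.
apply: malg_ext => i' x x'; rewrite /mscale /kraus.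
apply: (mulfI Hn0); rewrite mulVKf // (bigD1 i') //= [X in _ + X]big1 ?addr0; last first.
  move=> i ii'; rewrite big1 // => t _; rewrite big1 // => a _.
  by rewrite big1 // => b _; rewrite /kcomp_sig off // !mul0r.
rewrite sum_sig -(norm i') big_distrl; apply: eq_bigr => j _ /=.
transitivity (\sum_(f : E i' j) c i' j * (c i' j)^* * rho i' x x'); last first.
  by rewrite sumr_const -[_ *+ #|_|]mulr_natl mulrA.
rewrite sum_prod; apply: eq_bigr => f _.
transitivity (\sum_e (e == f)%:R * \sum_a (a == x)%:R * \sum_b (b == x')%:R *
   (c i' j * (c i' j)^* * rho i' a b)); last by rewrite !sum_delta.
apply: eq_bigr => e _; rewrite big_distrr; apply: eq_bigr => a _ /=.
rewrite !big_distrr; apply: eq_bigr => b _ /=.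
rewrite /kcomp_sig /= !diag rmorphM /= conjC_nat -!mulnb !natrM.
rewrite [x == a]eq_sym [x' == b]eq_sym [f == e]eq_sym.
case: (e == f) => /=; last by rewrite !(mulr0, mul0r).
ring.
Qed.

Section Converse.
Context {C : numClosedFieldType} {KA KB : finType}.
Context {DA : KA -> finType} {DB : KB -> finType} {H : finType}.
Context {E : KA -> KB -> finType}.
Variable K : forall i j, E i j -> mat C (DB j) (DA i * H).
Hypothesis A0 : forall i, (0 < #|DA i|)%N.
Hypothesis B0 : forall j, (0 < #|DB j|)%N.
Hypothesis H0 : (0 < #|H|)%N.
Hypothesis isoK : kiso K.
Hypothesis coisoK : kcoiso K.
Hypothesis tisoK : tiso K.
Hypothesis tcoisoK : tcoiso K.

Let a i : C := #|DA i|%:R.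
Let b j : C := #|DB j|%:R.
Let s i j := sqrtC (a i / b j).
Let an0 i : a i != 0. Proof. by rewrite pnatr_eq0 -lt0n. Qed.
Let bn0 j : b j != 0. Proof. by rewrite pnatr_eq0 -lt0n. Qed.
Let ss i j : s i j * s i j = a i / b j. Proof. by rewrite -expr2 sqrtCK. Qed.
Let sc i j : (s i j)^* = s i j.
Proof. by apply: geC0_conj; rewrite sqrtC_ge0 divr_ge0 ?ler0n. Qed.

(** The blocks of [W_j^*], sliced along [E]. *)
Definition tinv : forall j i, E i j -> mat C (DA i) (DB j * H) :=
  fun j i e x P => sqrtC (#|DA i|%:R / #|DB j|%:R) * (K i j e P.1 (x, P.2))^*.

Lemma kiso_tinv : kiso tinv.
Proof.
move=> j P Q; rewrite -[RHS](tcoisoK j); apply: eq_bigr => i _.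
rewrite exchange_big big_distrr; apply: eq_bigr => x _ /=.
rewrite big_distrr; apply: eq_bigr => e _ /=.
by rewrite /tinv -/(a i) -/(b j) -/(s i j) -ss rmorphM /= sc conjCK; ring.
Qed.

Let kcompL i i' j f e x x' : kcomp K tinv i i' j f e x x' =
  s i' j * \sum_P (K i' j f P.1 (x, P.2))^* * K i j e P.1 (x', P.2).
Proof. by rewrite /kcomp big_distrr; apply: eq_bigr => P _ /=; rewrite mulrA. Qed.

Let kcompR j j' i e f y y' : kcomp tinv K j j' i e f y y' =
  s i j * \sum_Q K i j' e y Q * (K i j f y' Q)^*.
Proof.
by rewrite /kcomp big_distrr; apply: eq_bigr => -[x h] _; rewrite mulrCA.
Qed.

(** Dimension count for the unitary [U_i]: the traces of [U_i^* U_i] and [U_i U_i^*] agree. *)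
Let sumEb i : \sum_j #|E i j|%:R * b j = a i * #|H|%:R.
Proof.
transitivity (\sum_(p : DA i * H) (1 : C)); last by rewrite sumr_const card_prod natrM.
transitivity (\sum_(p : DA i * H) \sum_j \sum_e \sum_y (K i j e y p)^* * K i j e y p);
  last by apply: eq_bigr => p _; rewrite isoK eqxx.
rewrite exchange_big; apply: eq_bigr => j _.
transitivity (\sum_(e : E i j) b j); first by rewrite sumr_const mulr_natl.
rewrite exchange_big; apply: eq_bigr => e _.
transitivity (\sum_(y : DB j) (1 : C)); first by rewrite sumr_const.
rewrite exchange_big; apply: eq_bigr => y _ /=.
under eq_bigr => p _ do rewrite mulrC.
by rewrite coisoK.2 !eqxx.
Qed.

(** The same count for [W_j]. *)
Let sumEa j : \sum_i #|E i j|%:R * a i = b j * #|H|%:R.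
Proof.
transitivity (\sum_(P : DB j * H) (1 : C)); last by rewrite sumr_const card_prod natrM.
transitivity (\sum_(P : DB j * H) \sum_i a i / b j *
   \sum_x \sum_e K i j e P.1 (x, P.2) * (K i j e P.1 (x, P.2))^*);
  last by apply: eq_bigr => P _; rewrite tcoisoK eqxx.
rewrite exchange_big; apply: eq_bigr => i _.
rewrite -big_distrr exchange_big big_distrr /=.
transitivity (\sum_(x : DA i) #|E i j|%:R : C); first by rewrite sumr_const mulr_natr.
apply: eq_bigr => x _; rewrite exchange_big big_distrr /=.
transitivity (\sum_(e : E i j) (1 : C)); first by rewrite sumr_const.
apply: eq_bigr => e _ /=.
under eq_bigr => p _ do rewrite mulrC.
by rewrite tisoK.2 !eqxx.
Qed.

Lemma tinv_left_inverse rho :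
  krausH tinv (ampl H (krausH K) (mtens rho (maxent C H))) = rho.
Proof.
(* [tiso] evaluates the bent inner product to [b j / a i], and [tinv] contributes [s i j]. The
   squared scalar is [b j / a i], so [sumEb] gives the normalisation. *)
apply: (krausH_inverse K tinv (fun i j => s i j * (b j / a i))) => //.
- by move=> i i' j f e x x' ii'; rewrite kcompL tisoK.1 ?mulr0 // eq_sym.
- move=> i j f e x x'; rewrite kcompL -tisoK.2 -/(a i) -/(b j).
  by field; rewrite an0 bn0.
move=> i; apply: (mulfI (an0 i)); rewrite -sumEb big_distrr; apply: eq_bigr => j _ /=.
rewrite rmorphM /= sc fmorph_div /= !conjC_nat -/(a i) -/(b j) mulrACA ss.
by field; rewrite an0 bn0.
Qed.

Lemma tinv_right_inverse sigma :
  krausH K (ampl H (krausH tinv) (mtens sigma (maxent C H))) = sigma.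
Proof.
(* Here [kcoiso] leaves only the factor [s i j], whose square is [a i / b j]; [sumEa] normalises
   it. *)
apply: (krausH_inverse (E := fun j i => E i j) tinv K (fun j i => s i j)) => //.
- by move=> j j' i e f y y' jj'; rewrite kcompR coisoK.1 ?mulr0 // eq_sym.
- by move=> j i e f y y'; rewrite kcompR coisoK.2 andbC mulrC.
move=> j; apply: (mulfI (bn0 j)); rewrite -sumEa big_distrr; apply: eq_bigr => i _ /=.
by rewrite sc ss; field; rewrite bn0.
Qed.

Lemma channel_tinv : channel (krausH tinv).
Proof.
split; [exact: mlinear_kraus|exact: cp_kraus|].
exact: ((kraus_tpP (D1 := prodD DB H) tinv).2 kiso_tinv).
Qed.
End Converse.

(** * Dilations *)

(** By this symmetry the right-inverse condition is the left-inverse condition with [M] and [N]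
    exchanged. *)
Lemma swapst_maxent (C : numClosedFieldType) (H : finType) :
  swapst (maxent C H) = maxent C H.
Proof.
by apply: mat_ext => p q; rewrite /swapst /maxent /= eq_sym [q.2 == _]eq_sym.
Qed.

Lemma unitaryP {C : numClosedFieldType} {I J : finType} (U : mat C I J) :
  unitary U <->
  (forall a b, \sum_p (U p a)^* * U p b = (a == b)%:R) /\
  (forall p q, \sum_a U p a * (U q a)^* = (p == q)%:R).
Proof.
split=> [[UU VV]|[UU VV]].
  split=> [a b|p q]; first by have := congr1 (fun A => A a b) UU.
  by have := congr1 (fun A => A p q) VV.
by split; apply: mat_ext => a b; [apply: UU|apply: VV].
Qed.

(** The operators [(1 (x) <e|) tau_ij], typed over [dimsp] to fit the abstract development. *)
Definition dil_kraus {C : numClosedFieldType} {m n : nat} {dX : 'I_m -> nat}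
  {dY : 'I_n -> nat} {dH : nat} {dE : 'I_n -> 'I_m -> nat}
  (tau : dil_type C dX dY dH dE) (i : 'I_m) (j : 'I_n) (e : 'I_(dE j i)) :
  mat C (dimsp dY j) (dimsp dX i * 'I_dH) := fun y a => tau i j (y, e) a.

Section Dilation.
Context {C : numClosedFieldType} {m n : nat} {dX : 'I_m -> nat}
  {dY : 'I_n -> nat} {dH : nat} {dE : 'I_n -> 'I_m -> nat}.
Variable tau : dil_type C dX dY dH dE.
Let K := (@dil_kraus C m n dX dY dH dE tau).

Lemma kiso_dil : dil_trace_pres tau <-> kiso K.
Proof.
split=> tp i a b; rewrite -tp; apply: eq_bigr => j _; rewrite sum_prod exchange_big //.
Qed.

(** Trace preservation is [U_i^* U_i = 1], so unitarity amounts to the other product, split by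
    whether the two blocks coincide. *)
Lemma unitary_Umap :
  dil_trace_pres tau -> (forall i, unitary (Umap tau i)) <-> kcoiso K.
Proof.
move=> tp; split=> [U|[off diag] i].
  split=> [i j j' e e' y y' jj'|i j e e' y y'].
    have /unitaryP [_ V] := U i.
    etransitivity; first exact: (V (Tagged (fun j => ('I_(dY j) * 'I_(dE j i))%type) (y, e))
      (Tagged (fun j => ('I_(dY j) * 'I_(dE j i))%type) (y', e'))).
    by rewrite (Tagged_neq (D := fun j => ('I_(dY j) * 'I_(dE j i))%type : finType)).
  have /unitaryP [_ V] := U i.
  etransitivity; first exact: (V (Tagged (fun j => ('I_(dY j) * 'I_(dE j i))%type) (y, e))
      (Tagged (fun j => ('I_(dY j) * 'I_(dE j i))%type) (y', e'))).
  by rewrite eq_Tagged /= xpair_eqE andbC.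
apply/unitaryP; split=> [a b|[j [y e]] [j' [y' e']]].
  by rewrite sum_sig -tp.
have [jj'|jj'] := eqVneq j j'.
  subst j'; rewrite eq_Tagged /= xpair_eqE andbC; exact: diag.
rewrite (Tagged_neq (D := fun j => ('I_(dY j) * 'I_(dE j i))%type : finType)) //.
exact: off.
Qed.

(** The weights are real and multiply to [dim X_i / dim Y_j] within a block; positive dimensions
    make them nonzero, so they cancel from the relations between distinct blocks. *)
Lemma unitary_Wmap :
  (forall i, 0 < dX i)%N -> (forall j, 0 < dY j)%N ->
  (forall j, unitary (Wmap tau j)) <-> tiso K /\ tcoiso K.
Proof.
move=> X0 Y0.
pose s i j : C := sqrtC ((dX i)%:R / (dY j)%:R).
have ss i j : s i j * s i j = (dX i)%:R / (dY j)%:R by rewrite -expr2 sqrtCK.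
have sc i j : (s i j)^* = s i j.
  by apply: geC0_conj; rewrite sqrtC_ge0 divr_ge0 ?ler0n.
have sn0 i j : s i j != 0.
  by rewrite sqrtC_eq0 mulf_neq0 ?invr_eq0 // pnatr_eq0 -lt0n.
have WE i j P x e :
  Wmap tau j P (Tagged (fun i => ('I_(dX i) * 'I_(dE j i))%type) (x, e)) =
  s i j * K i j e P.1 (x, P.2) by [].
have WW i i' j e e' x x' :
  \sum_P (Wmap tau j P (Tagged (fun i => ('I_(dX i) * 'I_(dE j i))%type) (x, e)))^* *
     Wmap tau j P (Tagged (fun i => ('I_(dX i) * 'I_(dE j i))%type) (x', e')) =
  s i j * s i' j * \sum_P (K i j e P.1 (x, P.2))^* * K i' j e' P.1 (x', P.2).
  rewrite big_distrr; apply: eq_bigr => P _ /=.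
  by rewrite !WE rmorphM /= sc; ring.
have VV j P Q : \sum_p Wmap tau j P p * (Wmap tau j Q p)^* =
  \sum_i #|dimsp dX i|%:R / #|dimsp dY j|%:R *
     \sum_x \sum_e K i j e P.1 (x, P.2) * (K i j e Q.1 (x, Q.2))^*.
  rewrite sum_sig; apply: eq_bigr => i _; rewrite sum_prod big_distrr.
  apply: eq_bigr => x _; rewrite big_distrr; apply: eq_bigr => e _ /=.
  by rewrite !WE rmorphM /= sc !card_ord -ss; ring.
split=> [W|[[off diag] co] j].
  split=> [|j P Q]; last by have /unitaryP [_ V] := W j; rewrite -VV V.
  split=> [i i' j e e' x x' ii'|i j e e' x x']; have /unitaryP [V _] := W j.
    apply: (mulfI (mulf_neq0 (sn0 i j) (sn0 i' j))); rewrite -WW V mulr0.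
    by rewrite (Tagged_neq (D := fun i => ('I_(dX i) * 'I_(dE j i))%type : finType)).
  by rewrite !card_ord -ss -WW V eq_Tagged /= xpair_eqE.
apply/unitaryP; split=> [[i [x e]] [i' [x' e']]|P Q]; last by rewrite VV co.
rewrite WW; have [ii'|ii'] := eqVneq i i'.
  subst i'; rewrite ss eq_Tagged /= xpair_eqE -diag.
  by rewrite !card_ord.
rewrite (Tagged_neq (D := fun i => ('I_(dX i) * 'I_(dE j i))%type : finType)) //.
by rewrite off // mulr0.
Qed.

End Dilation.

(** * Invertibility, unitarity and uniqueness for a minimal dilation *)

Theorem mainTheorem1 (C : numClosedFieldType) (m n : nat)
  (dX : 'I_m -> nat) (dY : 'I_n -> nat) (dH : nat) (dE : 'I_n -> 'I_m -> nat)
  (tau : forall i j, mat C ('I_(dY j) * 'I_(dE j i)) ('I_(dX i) * 'I_dH))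
  (M : malg C (prodD (dimsp dX) 'I_dH) -> malg C (dimsp dY)) :
  (forall i, (0 < dX i)%N) -> (forall j, (0 < dY j)%N) -> (0 < dH)%N ->
  channel M -> min_dilation tau M -> dil_trace_pres tau ->
  (ent_invertible M (maxent C 'I_dH) <->
     (forall i, unitary (Umap tau i)) /\ (forall j, unitary (Wmap tau j))) /\
  (forall N : malg C (prodD (dimsp dY) 'I_dH) -> malg C (dimsp dX),
     ent_inverse M N (maxent C 'I_dH) -> forall rho, N rho = Nform tau rho).
Proof.
move=> X0 Y0 dH0 chM [MK min] tp.
have A0 i : (0 < #|dimsp dX i|)%N by rewrite card_ord.
have B0 j : (0 < #|dimsp dY j|)%N by rewrite card_ord.
have H0 : (0 < #|'I_dH|)%N by rewrite card_ord.
pose K := dil_kraus tau.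
have isoK : kiso K by apply/kiso_dil.
have {}MK : M = krausH K.
  by apply: functional_extensionality => rho; apply: malg_ext => j y y'; apply: MK.
have free : kfree K by exact: min.
(* An arbitrary inverse is treated, so one argument serves both the forward implication and
   uniqueness. *)
have inverse N : ent_inverse M N (maxent C 'I_dH) ->
    [/\ kcoiso K, tiso K, tcoiso K & forall rho, N rho = Nform tau rho].
  case=> -[[linN cpN tpN] NM] MN; rewrite swapst_maxent in MN.
  have [F [L defN]] := kraus_exists N linN cpN.
  have {}defN : N = krausH (H := 'I_dH) L by [].
  rewrite defN MK in NM MN.
  have isoL : kiso (H := 'I_dH) L by apply/(kraus_tpP (D1 := prodD _ _)); rewrite -[kraus L]defN.
  have KL := krausH_inverse_scalar K L A0 H0 NM.
  have LK := krausH_inverse_scalar L K B0 H0 MN.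
  split; [exact: (inverse_kcoiso K L)|exact: (inverse_tiso K L)|exact: (inverse_tcoiso K L)|].
  move=> rho; apply: malg_ext => i x x'; rewrite defN (inverse_krausE K L) //.
  by apply: eq_bigr => j _; rewrite !card_ord.
split; last by move=> N /inverse [].
rewrite (unitary_Umap tau tp) (unitary_Wmap tau X0 Y0) -/K.
split=> [[N /inverse [? ? ? _]] //|[coisoK [tisoK tcoisoK]]].
exists (krausH (tinv K)); rewrite MK; split; first split.
- exact: channel_tinv.
- exact: tinv_left_inverse.
- by rewrite swapst_maxent; apply: tinv_right_inverse.
Qed.
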